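(* Let $d$ be a bounded distance on $\mathcal{S}^{q-1}$, let $H$ be a probability distribution on $\mathcal{S}^{q-1}$, and let $\theta\in\mathcal{S}^{q-1}$. Denote by $H_n$ the empirical distribution associated with a random sample of size $n$ from $H$. Then, as $n\to\infty$, $\sqrt{n}\,(D_d(\theta,H_n)-D_d(\theta,H))$ converges weakly to the normal distribution with mean zero and variance ${\rm Var}_H[d(\theta,W)]$.
   Context: Let $q\ge 2$ and $\mathcal{S}^{q-1}=\{x\in\mathbb{R}^q: x'x=1\}$, where $'$ denotes transpose. A distance $d$ on $\mathcal{S}^{q-1}$ is a metric on this set. For a bounded distance $d$ put $d^{\rm sup}=\sup\{d(\theta,\psi):\theta,\psi\in\mathcal{S}^{q-1}\}$. For a (Borel probability) distribution $H$ on $\mathcal{S}^{q-1}$, the directional $d$-depth of $\theta\in\mathcal{S}^{q-1}$ with respect to $H$ is $D_d(\theta,H)=d^{\rm sup}-E_H[d(\theta,W)]$, where $E_H$ (resp. ${\rm Var}_H$) is expectation (resp. variance) when $W$ has distribution $H$; it is understood that $w\mapsto d(\theta,w)$ is Borel measurable for every $\theta$, so that these make sense. The empirical distribution $H_n$ is that of the first $n$ terms $W_1,\dots,W_n$ of a sequence of i.i.d. random vectors with distribution $H$, so that $D_d(\theta,H_n)=d^{\rm sup}-\frac1n\sum_{i=1}^n d(\theta,W_i)$. A normal distribution with variance zero is the point mass at its mean. *)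

(* Defs.v *)
From HB Require Import structures.
From mathcomp Require Import all_boot all_order all_algebra finmap.
From mathcomp Require Import all_classical all_reals all_analysis.
From mathcomp Require Import measurable_realfun.

Set Implicit Arguments.
Unset Strict Implicit.
Unset Printing Implicit Defensive.

Import Order.TTheory GRing.Theory Num.Theory.
Import numFieldNormedType.Exports.

Local Open Scope classical_set_scope.
Local Open Scope ring_scope.

(* The unit sphere of R^q as a type of its own. A measurableType has to be
   pointed, which is why the type carries the assumption on q. *)
Definition usphere (R : realType) (q : nat) (hq : (2 <= q)%N) : Type :=
  set_type [set x : 'cV[R]_q | x^T *m x = 1%:M].

Section usphere_instances.
Context (R : realType) (q : nat) (hq : (2 <= q)%N).

Let i0 : 'I_q := Ordinal (ltnW hq).

Let usphere_point_subproof :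
  (delta_mx i0 0 : 'cV[R]_q) \in [set x : 'cV[R]_q | x^T *m x = 1%:M].
Proof.
by rewrite inE/= trmx_delta mul_delta_mx; apply/matrixP => i j;
  rewrite !mxE !ord1 !eqxx.
Qed.

Definition usphere_point : usphere R hq := exist (fun x => x \in _) _ usphere_point_subproof.

HB.instance Definition _ := Topological.copy (usphere R hq)
  (set_type [set x : 'cV[R]_q | x^T *m x = 1%:M]).
HB.instance Definition _ := isPointed.Build (usphere R hq) usphere_point.
(* Borel sigma-algebra of the topology inherited from R^q. *)
HB.instance Definition _ := Measurable.copy (usphere R hq)
  (g_sigma_algebraType (@open (usphere R hq))).

End usphere_instances.

Record distance (R : realType) (S : Type) (d : S -> S -> R) : Prop := Distance {
  distance_ge0 : forall x y, 0 <= d x y ;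
  distance_eq0 : forall x y, d x y = 0 <-> x = y ;
  distance_sym : forall x y, d x y = d y x ;
  distance_triangle : forall x y z, d x z <= d x y + d y z }.

Definition distance_values (R : realType) (S : Type) (d : S -> S -> R) : set R :=
  [set d x y | x in [set: S] & y in [set: S]].

Definition bounded_distance (R : realType) (S : Type) (d : S -> S -> R) : Prop :=
  has_ubound (distance_values d).

Definition dsup (R : realType) (S : Type) (d : S -> S -> R) : R :=
  sup (distance_values d).

Definition depth (R : realType) (disp : measure_display)
    (S : measurableType disp) (d : S -> S -> R) (theta : S)
    (H : probability S R) : R :=
  dsup d - fine 'E_H[d theta].

(* For 0 < n this is n^-1 times the sum of the Dirac masses at
   w 0, ..., w (n - 1); for n = 0 it is a junk probability. *)
Definition empirical (R : realType) (disp : measure_display)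
    (S : measurableType disp) (w : nat -> S) (n : nat) : probability S R :=
  mnormalize (msum (fun i => \d_(w i)) n) \d_point.

(* Mutual independence: the product rule over every finite subfamily. *)
Definition mutually_independent (R : realType) (dO dS : measure_display)
    (Omega : measurableType dO) (S : measurableType dS)
    (P : probability Omega R) (I : choiceType) (W : I -> {RV P >-> S}) : Prop :=
  forall (J : {fset I}) (A : I -> set S), (forall i, measurable (A i)) ->
  P (\bigcap_(i in [set` J]) (W i @^-1` A i)) =
    (\prod_(i <- J) P (W i @^-1` A i))%E.

Definition iid (R : realType) (dO dS : measure_display)
    (Omega : measurableType dO) (S : measurableType dS)
    (P : probability Omega R) (I : choiceType) (W : I -> {RV P >-> S})
    (H : probability S R) : Prop :=
  mutually_independent W /\
  forall i (A : set S), measurable A -> distribution P (W i) A = H A.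

(* Weak convergence to mu of the laws of the random variables Z n; the first
   clause makes Z n a random variable, so that its law exists. *)
Definition weakly_converges (R : realType) (dO : measure_display)
    (Omega : measurableType dO) (P : probability Omega R)
    (Z : nat -> Omega -> R) (mu : probability (measurableTypeR R) R) : Prop :=
  (forall n, measurable_fun [set: Omega] (Z n)) /\
  forall f : R -> R, continuous f -> bounded_fun f ->
    'E_P[f \o Z n]%E @[n --> \oo] --> (\int[mu]_x (f x)%:E)%E.

(* normal_prob takes a standard deviation, and for standard deviation 0 it is
   the uniform law on [0, 1], hence the case distinction. *)
Definition normal_law (R : realType) (m v : R) :
    probability (measurableTypeR R) R :=
  if v == 0 then (\d_(m : measurableTypeR R) : probability (measurableTypeR R) R)
  else (normal_prob m (Num.sqrt v) : probability (measurableTypeR R) R).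

Section empirical_depth.
Local Open Scope ereal_scope.
Context (R : realType) (disp : measure_display) (S : measurableType disp).

Lemma empiricalE (w : nat -> S) (n : nat) (A : set S) : (0 < n)%N ->
  empirical R w n A = (\sum_(i < n) \d_(w i) A) * (n%:R^-1)%:E.
Proof.
move=> n0; rewrite /empirical /= /mnormalize /= /msum.
have -> : \sum_(k < n) \d_(w k) [set: S] = n%:R%:E :> \bar R.
  under eq_bigr do rewrite diracT.
  by rewrite sumEFin sumr_const card_ord.
by rewrite eqe pnatr_eq0 gtn_eqF.
Qed.

Lemma depth_empirical (d : S -> S -> R) (theta : S) (w : nat -> S) (n : nat) :
  (0 < n)%N -> distance d -> measurable_fun [set: S] (d theta) ->
  depth d theta (empirical R w n) =
    (dsup d - n%:R^-1 * \sum_(i < n) d theta (w i))%R.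
Proof.
move=> n0 dd md; rewrite /depth unlock; congr (_ - _)%R.
have nn : (0 <= n%:R^-1 :> R)%R by rewrite invr_ge0.
have mE : measurable_fun [set: S] (fun x => (d theta x)%:E).
  exact/measurable_EFinP.
rewrite (eq_measure_integral
  (mscale (NngNum nn) (msum (fun i => \d_(w i)) n))); last first.
  move=> A mA _; rewrite [LHS]empiricalE// /mscale /= /msum.
  by rewrite muleC.
have d0 (x : S) : [set: S] x -> 0 <= (d theta x)%:E.
  by move=> _; rewrite lee_fin; exact: distance_ge0.
rewrite ge0_integral_mscale// ge0_integral_measure_sum//.
under eq_bigr do rewrite integral_dirac// diracT mul1e.
by rewrite sumEFin.
Qed.

End empirical_depth.

(* Main.v *)
Require Import Defs.
From HB Require Import structures.
From mathcomp Require Import all_boot all_order all_algebra finmap ring.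
From mathcomp Require Import all_classical all_reals all_analysis.
From mathcomp Require Import measurable_realfun.

Import Order.TTheory GRing.Theory Num.Theory.
Import numFieldNormedType.Exports.

Local Open Scope classical_set_scope.
Local Open Scope ring_scope.

(** The theorem is the central limit theorem for the bounded i.i.d. variables
    X_i = E_H[d(theta, W)] - d(theta, W_i): the constant dsup cancels in the
    difference of the two depths, which is the empirical mean of the X_i.

    The central limit theorem is proved by Stein's method.  Let v = Var X_i,
    assume v != 0, let N be the centred normal law of variance v and p its
    density.  Every bounded continuous f gives rise to a function g with
      v g'(x) - x g(x) = f(x) - E f(N),
    namely g = (v p)^-1 * int_{-oo}^x (f - E f(N)) p.  The total integral of
    (f - E f(N)) p is 0, so the integral over the left of x is minus the
    integral over the right of x; estimating whichever of them is a tail by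
    |x| int_tail p <= v p(x) shows that x g(x), hence g', is bounded
    [stein_equation_solvable].  It remains to see that
      E[Z g(Z)] - v E[g'(Z)] --> 0   for   Z = n^-(1/2) (X_1 + ... + X_n).
    Write Z = U_i + x_i where x_i = n^-(1/2) X_i is independent of the sum U_i
    of the other terms.  As E x_i = 0 and E x_i^2 = v / n, expanding
    g(U_i + x_i) to the first order gives
      E[x_i g(Z)] = (v / n) E[g'(U_i)] + error,
    and the sum over i of these identities is the claim up to errors controlled
    by the modulus of continuity of g'.  Although g' need not be uniformly
    continuous, it is continuous and bounded, hence
    |g'(z + y) - g'(z)| <= e (1 + z^2) for all z and all small y
    [quadratic_modulus]; this is enough because E[U_i^2] <= v
    [stein_discrepancy_le].

    For v = 0 all the sums vanish almost surely and the limit is the point mass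
    at 0.  The independence of x_i and U_i comes from the product rule on finite
    families by a pi-system argument [independent_of_others]. *)

(** * Estimates on functions of a real variable *)

Lemma is_derive_continuous {R : realType} (g g' : R -> R) :
  (forall x : R, is_derive x 1 g (g' x)) -> continuous g.
Proof.
move=> dg x; have ? := dg x.
by apply/differentiable_continuous/derivable1_diffP; exact: ex_derive.
Qed.

Lemma continuous_bounded_segment {R : realType} (g : R -> R) (M : R) :
  continuous g -> exists K, forall x, `|x| <= M -> `|g x| <= K.
Proof.
move=> cg.
have : bounded_set (g @` `[- M, M]).
  apply: compact_bounded; apply: continuous_compact;
    last exact: segment_compact.
  exact: continuous_subspaceT.
case=> K [_ HK]; exists (K + 1) => x xM.
apply: (HK (K + 1)); first by rewrite ltrDl.
by exists x => //=; rewrite in_itv/= -ler_norml.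
Qed.

(** On a segment [-K, K] this is uniform continuity; outside of it
    e (1 + z^2) exceeds 2 C as soon as K is large, so boundedness suffices.
    The quadratic weight is the one that a bounded second moment absorbs. *)
Lemma quadratic_modulus {R : realType} (g : R -> R) (C : R) :
  continuous g -> (forall x, `|g x| <= C) -> forall e : R, 0 < e ->
  exists2 d : R, 0 < d & forall z y, `|y| <= d ->
    `|g (z + y) - g z| <= e * (1 + z ^+ 2).
Proof.
move=> cg gC e e0.
have C0 : 0 <= C by exact: le_trans (gC 0).
(* K >= 1 ensures K <= K ^ 2, so that z ^ 2 >= 2 C / e when |z| > K. *)
pose K := 1 + 2 * C / e.
have : \forall y \near (0 : R), `[- K, K] `<=` [set z | `|g (z + y) - g z| < e].
  have cov : near_covering (`[- K, K]%classic : set R).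
    by apply/compact_near_coveringP; exact: segment_compact.
  apply: (cov R (nbhs (0 : R)) (fun y z => `|g (z + y) - g z| < e)) => z _.
  have cD : (fun t : R * R => g (t.1 + t.2) - g t.1) @ ((z, 0) : R * R) -->
      (0 : R).
    rewrite -[X in _ --> X](subrr (g z)); apply: cvgB.
      rewrite -[X in _ --> g X](addr0 z).
      apply: (@cvg_comp _ _ _ (fun t : R * R => t.1 + t.2) g _ (nbhs (z + 0))
        _ _ (cg _)).
      by apply: cvgD; [exact: cvg_fst|exact: cvg_snd].
    apply: (@cvg_comp _ _ _ (fun t : R * R => t.1) g _ (nbhs z) _ _ (cg z)).
    exact: cvg_fst.
  have /cvgr0_norm_lt/(_ _ e0) := cD.
  by apply: filterS => -[z' y] /= H.
move=> /nbhs_ballP[d /= d0 Hd].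
exists (d / 2); first by rewrite divr_gt0.
move=> z y yd.
have [zK|zK] := leP `|z| K.
  apply: (@le_trans _ _ e); last by rewrite ler_peMr ?(ltW e0)// lerDl sqr_ge0.
  apply/ltW/(Hd y); last by rewrite /= in_itv/= -ler_norml.
  rewrite /ball/= sub0r normrN (le_lt_trans yd)// ltr_pdivrMr// ltr_pMr//.
  by rewrite ltr1n.
apply: (@le_trans _ _ (2 * C)).
  by rewrite (le_trans (ler_normB _ _))// mulr_natl mulr2n lerD.
have K1 : 1 <= K by rewrite lerDl divr_ge0 ?mulr_ge0// ltW.
have zz : 2 * C / e <= z ^+ 2.
  rewrite -real_normK ?num_real//.
  rewrite (le_trans _ (lerXn2r _ _ _ (ltW zK))) ?nnegrE//;
    last by rewrite (le_trans ler01).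
  by rewrite expr2 (le_trans _ (ler_peMl _ K1)) ?(le_trans ler01)// /K lerDr.
rewrite -ler_pdivrMl// mulrC (le_trans zz)// lerDr//.
Qed.

(** First-order Taylor expansion whose remainder inherits, by the mean value
    theorem, the weight of the modulus of continuity of the derivative. *)
Lemma quadratic_taylor {R : realType} (g g' : R -> R) (e d : R) :
  (forall x : R, is_derive x 1 g (g' x)) ->
  (forall z y, `|y| <= d -> `|g' (z + y) - g' z| <= e * (1 + z ^+ 2)) ->
  forall z y, `|y| <= d ->
    `|g (z + y) - g z - y * g' z| <= e * `|y| * (1 + z ^+ 2).
Proof.
move=> dg Hg' z y yd.
have cg := is_derive_continuous _ _ dg.
have [c cy ->] : exists2 c, `|c| <= `|y| & g (z + y) - g z = y * g' (z + c).
  have [y0|y0|->] := ltgtP y 0.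
  - have lt : z + y < z by rewrite gtrDl.
    have [x] := MVT lt (fun x _ => dg x) (continuous_subspaceT cg).
    rewrite in_itv/= => /andP[zx xz] E; exists (x - z).
      by rewrite !ltr0_norm ?subr_lt0// lerN2 lerBrDl ltW.
    by rewrite subrKC -(opprB (g z)) E; ring.
  - have lt : z < z + y by rewrite ltrDl.
    have [x] := MVT lt (fun x _ => dg x) (continuous_subspaceT cg).
    rewrite in_itv/= => /andP[zx xz] E; exists (x - z).
      by rewrite !gtr0_norm ?subr_gt0// lerBlDl ltW.
    by rewrite subrKC E; ring.
  - by exists 0 => //; rewrite !addr0 subrr mul0r.
rewrite -mulrBr normrM mulrAC mulrC ler_wpM2r//.
by apply: Hg'; rewrite (le_trans cy).
Qed.

(** * Bounded measurable functions on a probability space *)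

Section bounded_measurable.
Context {d} {T : measurableType d} {R : realType}.

Definition bounded_mfun (u : T -> R) :=
  measurable_fun [set: T] u /\ exists M, forall w, `|u w| <= M.

Lemma bounded_mfun_cst (c : R) : bounded_mfun (fun=> c).
Proof. by split; [exact: measurable_cst|exists `|c|]. Qed.

Lemma bounded_mfunD (u v : T -> R) : bounded_mfun u -> bounded_mfun v ->
  bounded_mfun (fun w => u w + v w).
Proof.
move=> [mu [M uM]] [mv [N vN]]; split; first exact: measurable_funD.
by exists (M + N) => w; rewrite (le_trans (ler_normD _ _))// lerD.
Qed.

Lemma bounded_mfunM (u v : T -> R) : bounded_mfun u -> bounded_mfun v ->
  bounded_mfun (fun w => u w * v w).
Proof.
move=> [mu [M uM]] [mv [N vN]]; split; first exact: measurable_funM.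
by exists (M * N) => w; rewrite normrM ler_pM.
Qed.

Lemma bounded_mfunB (u v : T -> R) : bounded_mfun u -> bounded_mfun v ->
  bounded_mfun (fun w => u w - v w).
Proof.
move=> [mu [M uM]] [mv [N vN]]; split; first exact: measurable_funB.
by exists (M + N) => w; rewrite (le_trans (ler_normB _ _))// lerD.
Qed.

Lemma bounded_mfunX (u : T -> R) n : bounded_mfun u ->
  bounded_mfun (fun w => u w ^+ n).
Proof.
move=> [mu [M uM]]; split; first exact: measurable_funX.
by exists (M ^+ n) => w; rewrite normrX lerXn2r ?nnegrE// (le_trans _ (uM w)).
Qed.

Lemma bounded_mfun_sum (I : Type) (r : seq I) (Q : pred I) (u : I -> T -> R) :
  (forall i, bounded_mfun (u i)) ->
  bounded_mfun (fun w => \sum_(i <- r | Q i) u i w).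
Proof.
move=> bu; elim: r => [|i r IH].
  by under eq_fun do rewrite big_nil; exact: bounded_mfun_cst.
under eq_fun do rewrite big_cons.
by case: (Q i) => //; exact: bounded_mfunD.
Qed.

Lemma bounded_mfun_continuous (g : R -> R) (u : T -> R) :
  continuous g -> bounded_mfun u -> bounded_mfun (fun w => g (u w)).
Proof.
move=> cg [mu [M uM]]; split.
  by apply: measurableT_comp mu; exact: continuous_measurable_fun.
have [K gK] := continuous_bounded_segment g M cg.
by exists K => w; exact: gK.
Qed.

Lemma bounded_mfun_norm (u : T -> R) : bounded_mfun u ->
  bounded_mfun (fun w => `|u w|).
Proof. by apply: bounded_mfun_continuous; exact: norm_continuous. Qed.

Context (P : probability T R).

Lemma bounded_mfun_integrable (u : T -> R) : bounded_mfun u ->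
  P.-integrable setT (EFin \o u).
Proof.
move=> [mu [M uM]]; apply: measurable_bounded_integrable => //.
  exact: fin_num_fun_lty.
exists M; split; first exact: num_real.
by move=> x Mx w _; exact: le_trans (uM w) (ltW Mx).
Qed.

Lemma RintegralD_bounded (u v : T -> R) : bounded_mfun u -> bounded_mfun v ->
  \int[P]_w (u w + v w) = \int[P]_w u w + \int[P]_w v w.
Proof.
by move=> bu bv; apply: RintegralD => //; exact: bounded_mfun_integrable.
Qed.

Lemma RintegralB_bounded (u v : T -> R) : bounded_mfun u -> bounded_mfun v ->
  \int[P]_w (u w - v w) = \int[P]_w u w - \int[P]_w v w.
Proof.
by move=> bu bv; apply: RintegralB => //; exact: bounded_mfun_integrable.
Qed.

Lemma RintegralZl_bounded c (u : T -> R) : bounded_mfun u ->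
  \int[P]_w (c * u w) = c * \int[P]_w u w.
Proof.
by move=> bu; apply: RintegralZl => //; exact: bounded_mfun_integrable.
Qed.

Lemma Rintegral_cst_probability c : \int[P]_(_ in [set: T]) c = c.
Proof.
rewrite Rintegral_cst// (_ : (P : {measure set T -> \bar R}) setT = 1%E)
  ?mulr1//.
exact: probability_setT.
Qed.

Lemma Rintegral_sum_bounded (I : Type) (r : seq I) (u : I -> T -> R) :
  (forall i, bounded_mfun (u i)) ->
  \int[P]_w (\sum_(i <- r) u i w) = \sum_(i <- r) \int[P]_w u i w.
Proof.
move=> bu; elim: r => [|i r IH].
  under eq_Rintegral do rewrite big_nil.
  by rewrite big_nil Rintegral_cst_probability.
under eq_Rintegral do rewrite big_cons.
by rewrite big_cons RintegralD_bounded ?IH//; exact: bounded_mfun_sum.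
Qed.

Lemma normr_Rintegral_le_bounded (u v : T -> R) :
  bounded_mfun u -> bounded_mfun v ->
  (forall w, `|u w| <= v w) -> `|\int[P]_w u w| <= \int[P]_w v w.
Proof.
move=> bu bv uv.
rewrite (le_trans (le_normr_Rintegral _ (bounded_mfun_integrable _ bu)))//.
have := bounded_mfun_integrable _ (bounded_mfun_norm _ bu).
by move=> iu; apply: le_Rintegral => //; exact: bounded_mfun_integrable.
Qed.

End bounded_measurable.

Lemma continuous_bounded_mfun {R : realType} (f : R -> R) :
  continuous f -> bounded_fun f -> bounded_mfun f.
Proof.
move=> cf [M [_ fM]]; split; first exact: continuous_measurable_fun.
by exists (M + 1) => x; apply: (fM (M + 1)) => //; rewrite ltrDl.
Qed.

(** * Stein's equation for the normal law *)

Section normal_density.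
Context {R : realType} (s : R).
Context (s0 : s != 0).
Local Notation mu := (@lebesgue_measure R).
Local Notation p := (normal_pdf 0 s).

(** The density of a measure is unique up to a null set, so the
    Radon-Nikodym derivative of the normal law can be replaced by the pdf. *)
Lemma integral_normal_prob (f : R -> R) :
  (normal_prob 0 s).-integrable setT (EFin \o f) ->
  (\int[normal_prob 0 s]_x (f x)%:E = \int[mu]_x (f x * p x)%:E)%E.
Proof.
move=> intf.
rewrite -(Radon_Nikodym_change_of_variables (normal_prob_dominates 0 s))//=.
have mf := measurable_int _ intf.
have mp : measurable_fun [set: R] (fun x => (p x)%:E : \bar R).
  by apply/measurable_EFinP; exact: measurable_normal_pdf.
apply: ae_eq_integral => //.
- apply: emeasurable_funM => //.
  apply: (measurable_int mu); apply: Radon_Nikodym_integrable.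
  exact: normal_prob_dominates.
- apply/measurable_EFinP/measurable_funM; first exact/measurable_EFinP.
  exact: measurable_normal_pdf.
- under [X in ae_eq _ _ _ X]eq_fun do rewrite EFinM.
  apply: ae_eqe_mul2l.
  apply: integral_ae_eq => //.
  + apply: Radon_Nikodym_integrable; exact: normal_prob_dominates.
  + move=> E _ mE; rewrite -Radon_Nikodym_integral//.
    exact: normal_prob_dominates.
Qed.

Lemma normal_pdf_gt0 x : 0 < p x.
Proof. by rewrite normal_pdfE// mulr_gt0 ?expR_gt0// normal_peak_gt0. Qed.

Lemma normal_pdfN x : p (- x) = p x.
Proof. by rewrite normal_pdfE// /normal_fun !subr0 sqrrN. Qed.

Lemma is_derive_normal_pdf (x : R) : is_derive x 1 p (- (x / s ^+ 2) * p x).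
Proof.
rewrite normal_pdfE// /normal_fun.
apply: is_derive_eq.
rewrite /GRing.scale /= !subr0.
by field; rewrite s0.
Qed.

Lemma cvg_normal_pdfy : p x @[x --> +oo] --> (0 : R).
Proof.
rewrite normal_pdfE// /normal_fun -[X in _ --> X](mulr0 (normal_peak s)).
apply: cvgMr; rewrite /=.
under eq_fun do rewrite subr0 mulNr.
apply: (@cvg_comp _ _ _ (fun x => x ^+ 2 / (s ^+ 2 *+ 2)) (fun y => expR (- y))
  _ +oo);
  last exact: cvgr_expR.
apply: gt0_cvgMly; last exact: cvgr_expr2.
by rewrite invr_gt0 pmulrn_lgt0// exprn_even_gt0.
Qed.

Let cp : continuous p.
Proof. exact: continuous_normal_pdf. Qed.

(** The derivative of p is - x / s^2 * p, so - s^2 * p is a primitive. *)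
Lemma integral_id_normal_pdf (x : R) : 0 <= x ->
  (\int[mu]_(y in `[x, +oo[) (y * p y)%:E = (s ^+ 2 * p x)%:E)%E.
Proof.
move=> x0.
have dF (y : R) : is_derive y 1 (fun y => - s ^+ 2 * p y) (y * p y).
  have ? := is_derive_normal_pdf y.
  apply: is_derive_eq; rewrite /GRing.scale /=.
  by field.
rewrite (@ge0_continuous_FTC2y _ _ (fun y => - s ^+ 2 * p y) _ 0).
- by rewrite sub0e -EFinN mulNr opprK.
- by move=> y xy; rewrite mulr_ge0 ?normal_pdf_ge0// (le_trans x0).
- apply: continuous_subspaceT => y; apply: cvgM; [exact: cvg_id|exact: cp].
- rewrite -[X in _ --> X](mulr0 (- s ^+ 2)); apply: cvgMr.
  exact: cvg_normal_pdfy.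
- by move=> y _; exact: ex_derive.
- apply: cvg_at_right_filter; apply: cvgMr; exact: cp.
- by move=> y _; rewrite derive1E; exact: derive_val.
Qed.

Lemma integrable_normal_pdfS (D : set (measurableTypeR R)) : measurable D ->
  mu.-integrable D (EFin \o p).
Proof.
by move=> mD; apply: integrableS (integrable_normal_pdf 0 s).
Qed.

(** Mills' inequality: on the tail, x <= y inside the integral of y * p y. *)
Lemma normal_pdf_right_tail (x : R) : 0 <= x ->
  x * \int[mu]_(y in `[x, +oo[) p y <= s ^+ 2 * p x.
Proof.
move=> x0; rewrite -RintegralZl//; last exact: integrable_normal_pdfS.
have -> : s ^+ 2 * p x = \int[mu]_(y in `[x, +oo[) (y * p y).
  by rewrite /Rintegral integral_id_normal_pdf.
have mfp : measurable_fun `[x, +oo[ (fun y => y * p y).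
  apply: measurable_funM => //; apply: measurable_funTS.
  exact: measurable_normal_pdf.
apply: le_Rintegral => //.
- have := integrableZl measurableT x (integrable_normal_pdf 0 s).
  by apply: integrableS.
- apply/integrableP; split; first exact/measurable_EFinP.
  suff -> : (\int[mu]_(y in `[x, +oo[)
        `|(EFin \o (fun y : R => (y * p y)%R)) y| =
      \int[mu]_(y in `[x, +oo[) (y * p y)%:E)%E.
    by rewrite integral_id_normal_pdf// ltry.
  apply: eq_integral => y; rewrite inE/= in_itv/= andbT => xy.
  by rewrite ger0_norm// mulr_ge0 ?normal_pdf_ge0// (le_trans x0).
- move=> y; rewrite /= in_itv/= andbT => xy.
  by rewrite ler_wpM2r ?normal_pdf_ge0.
Qed.

Lemma normal_pdf_left_tail (x : R) : x <= 0 ->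
  - x * \int[mu]_(y in `]-oo, x]) p y <= s ^+ 2 * p x.
Proof.
move=> x0; rewrite -[in leRHS](normal_pdfN x).
have -> : \int[mu]_(y in `]-oo, x]) p y = \int[mu]_(y in `[- x, +oo[) p y.
  rewrite /Rintegral; congr fine; rewrite -[in LHS](opprK x).
  rewrite ge0_integration_by_substitutionNy.
  - by apply: eq_integral => y _ /=; rewrite normal_pdfN.
  - apply: continuous_subspaceT; exact: cp.
  - by move=> y _; exact: normal_pdf_ge0.
by apply: normal_pdf_right_tail; rewrite oppr_ge0.
Qed.

Lemma integrable_mul_normal_pdf (h : R -> R) (B : R)
    (D : set (measurableTypeR R)) :
  continuous h -> (forall x, `|h x| <= B) -> measurable D ->
  mu.-integrable D (EFin \o (fun x => h x * p x)).
Proof.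
move=> ch hB mD; apply: (integrableS measurableT) => //.
have ip := integrableZl measurableT B (integrable_normal_pdf 0 s).
apply: le_integrable ip => //.
  apply/measurable_EFinP; apply: measurable_funM.
    exact: continuous_measurable_fun.
  exact: measurable_normal_pdf.
move=> x _ /=; rewrite lee_fin; apply: le_trans (ler_norm _).
by rewrite normrM (ger0_norm (normal_pdf_ge0 _ _ _)) ler_wpM2r ?normal_pdf_ge0.
Qed.

Section stein_solution.
Context (h : R -> R) (B : R) (ch : continuous h) (hB : forall x, `|h x| <= B).
Context (h0 : \int[mu]_x (h x * p x) = 0).

Let integrable_hp (D : set (measurableTypeR R)) : measurable D ->
  mu.-integrable D (EFin \o (fun x => h x * p x)).
Proof. exact: integrable_mul_normal_pdf ch hB. Qed.

Let hp_int_le (D : set (measurableTypeR R)) : measurable D ->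
  `|\int[mu]_(x in D) (h x * p x)| <= B * \int[mu]_(x in D) p x.
Proof.
move=> mD; apply: (le_trans (le_normr_Rintegral mD (integrable_hp _ mD))).
rewrite -RintegralZl//; last exact: integrable_normal_pdfS.
apply: le_Rintegral => //.
- exact: (integrable_norm (integrable_hp _ mD)).
- exact: (integrableZl mD B (integrable_normal_pdfS _ mD)).
- move=> x _; rewrite normrM (ger0_norm (normal_pdf_ge0 _ _ _)).
  by rewrite ler_wpM2r ?normal_pdf_ge0.
Qed.

(** The numerator of the solution: h * p is the derivative of s^2 * p * g
    exactly when g solves Stein's equation with right-hand side h. *)
Definition stein_primitive (x : R) := \int[mu]_(y in `]-oo, x]) (h y * p y).

Lemma is_derive_stein_primitive (x : R) :
  is_derive x 1 stein_primitive (h x * p x).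
Proof.
have xx1 : x < x + 1 by rewrite ltrDl.
have mI : measurable (`]-oo, x + 1]%classic : set (measurableTypeR R)) by [].
have chp : {for x, continuous (fun y => h y * p y)}.
  by apply: cvgM; [exact: ch|exact: cp].
have [dG dGE] := continuous_FTC1 xx1 (integrable_hp _ mI) (ltNyr _) chp.
by rewrite -[X in is_derive _ _ _ X]dGE derive1E; exact/derivableP.
Qed.

(** Since h * p has integral 0, the primitive is, up to sign, the integral over
    either side of x; the side away from the origin is a tail. *)
Lemma stein_primitive_le (x : R) :
  `|x * stein_primitive x| <= B * (s ^+ 2 * p x).
Proof.
have B0 : 0 <= B by exact: le_trans (hB 0).
have [x0|x0] := leP 0 x.
  have -> : stein_primitive x = - \int[mu]_(y in `[x, +oo[) (h y * p y).
    rewrite -Rintegral_itv_obnd_cbnd; last exact: integrable_hp.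
    rewrite -(@Rintegral_itvB _ _ -oo%O) ?bnd_simp//; last exact: integrable_hp.
    by rewrite set_itvNyy h0 sub0r opprK.
  rewrite mulrN normrN normrM ger0_norm//.
  rewrite (le_trans (ler_wpM2l x0 (hp_int_le _ _)))// mulrCA ler_wpM2l//.
  exact: normal_pdf_right_tail.
rewrite normrM ltr0_norm//.
have Nx0 : 0 <= - x by rewrite oppr_ge0 ltW.
rewrite (le_trans (ler_wpM2l Nx0 (hp_int_le _ _)))// mulrCA ler_wpM2l//.
by apply: normal_pdf_left_tail; exact: ltW.
Qed.

Definition stein_solution (x : R) := stein_primitive x / (s ^+ 2 * p x).

(** The derivative of the solution, in the form read off from the equation. *)
Definition stein_solution' (x : R) := (h x + x * stein_solution x) / s ^+ 2.

Lemma is_derive_stein_solution (x : R) :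
  is_derive x 1 stein_solution (stein_solution' x).
Proof.
have ? := is_derive_stein_primitive x.
have ? := is_derive_normal_pdf x.
have px0 := lt0r_neq0 (normal_pdf_gt0 x).
have d0 : s ^+ 2 * p x != 0 by rewrite mulf_neq0// expf_neq0.
have dV : is_derive x 1 (fun y => (s ^+ 2 * p y)^-1)
   (- (s ^+ 2 * p x) ^- 2 *: (s ^+ 2 *: (- (x / s ^+ 2) * p x))).
  exact: is_deriveV.
rewrite /stein_solution; apply: is_derive_eq.
rewrite /stein_solution' /stein_solution /GRing.scale /=.
by field; rewrite s0 px0.
Qed.

Lemma stein_solution'_continuous : continuous stein_solution'.
Proof.
move=> x; apply: cvgMl; apply: cvgD; first exact: ch.
apply: cvgM; first exact: cvg_id.
exact: (is_derive_continuous _ _ is_derive_stein_solution).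
Qed.

Lemma stein_solution'_le (x : R) : `|stein_solution' x| <= 2 * B / s ^+ 2.
Proof.
have s2 : 0 < s ^+ 2 by rewrite exprn_even_gt0.
have sp : 0 < s ^+ 2 * p x by rewrite mulr_gt0 ?normal_pdf_gt0.
rewrite normrM normfV (gtr0_norm s2) ler_pM2r ?invr_gt0//.
rewrite (le_trans (ler_normD _ _))// mulr_natl mulr2n lerD//.
rewrite mulrA normrM normfV (gtr0_norm sp) ler_pdivrMr//.
exact: stein_primitive_le.
Qed.

Lemma stein_equation (x : R) :
  s ^+ 2 * stein_solution' x - x * stein_solution x = h x.
Proof. by rewrite mulrCA divff ?mulr1 ?expf_neq0// addrK. Qed.

End stein_solution.
End normal_density.

(** The boundedness of g' is what makes [quadratic_modulus] applicable. *)
Lemma stein_equation_solvable {R : realType} (s : R) (f : R -> R) :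
  s != 0 -> continuous f -> bounded_fun f ->
  exists g g' : R -> R, [/\ forall x : R, is_derive x 1 g (g' x),
    continuous g', exists C, forall x, `|g' x| <= C &
    forall x, s ^+ 2 * g' x - x * g x = f x - \int[normal_prob 0 s]_y f y].
Proof.
move=> s0 cf bdf.
pose c := \int[normal_prob 0 s]_y f y.
have bf := continuous_bounded_mfun f cf bdf.
have fi := bounded_mfun_integrable (normal_prob 0 s) f bf.
have cE : c = \int[lebesgue_measure]_y (f y * normal_pdf 0 s y).
  by rewrite /c /Rintegral integral_normal_prob.
pose h x := f x - c.
have ch : continuous h by move=> x; apply: cvgB; [exact: cf|exact: cvg_cst].
have [B hB] : exists B, forall x, `|h x| <= B.
  case: bf => _ [M fM]; exists (M + `|c|) => x.
  by rewrite (le_trans (ler_normB _ _))// lerD.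
have h0 : \int[lebesgue_measure]_y (h y * normal_pdf 0 s y) = 0.
  case: bf => _ [M fM].
  have ifp := integrable_mul_normal_pdf s f M setT cf fM measurableT.
  have ip := integrable_normal_pdf 0 s.
  under eq_Rintegral do rewrite mulrBl.
  rewrite RintegralB//; last exact: (integrableZl _ c ip).
  by rewrite RintegralZl// -cE /Rintegral integral_normal_pdf mulr1 subrr.
exists (stein_solution s h), (stein_solution' s h); split.
- exact: is_derive_stein_solution.
- exact: stein_solution'_continuous.
- by exists (2 * B / s ^+ 2) => x; exact: stein_solution'_le.
- exact: stein_equation.
Qed.

(** * Independence *)

Section independence.
Context {d} {T : measurableType d} {R : realType} (P : probability T R).

(** The product rule on rectangles says that the law of (U, V) is the product of
    the laws of U and V; the rest is Fubini's theorem. *)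
Lemma Rintegral_independent_mul {d1 d2} {T1 : measurableType d1}
    {T2 : measurableType d2} (U : T -> T1) (V : T -> T2)
    (a : T1 -> R) (b : T2 -> R) :
  measurable_fun setT U -> measurable_fun setT V ->
  (forall A B, measurable A -> measurable B ->
    P (U @^-1` A `&` V @^-1` B) = (P (U @^-1` A) * P (V @^-1` B))%E) ->
  measurable_fun setT a -> measurable_fun setT b ->
  bounded_mfun (fun w => a (U w)) -> bounded_mfun (fun w => b (V w)) ->
  \int[P]_w (a (U w) * b (V w)) = \int[P]_w a (U w) * \int[P]_w b (V w).
Proof.
move=> mU mV UV ma mb ba bb.
pose U' : {mfun T >-> T1} := HB.pack U (isMeasurableFun.Build _ _ _ _ U mU).
pose V' : {mfun T >-> T2} := HB.pack V (isMeasurableFun.Build _ _ _ _ V mV).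
have mUV : measurable_fun setT (fun w => (U w, V w)).
  exact: measurable_fun_pair.
pose UV' : {mfun T >-> (T1 * T2)%type} :=
  HB.pack (fun w => (U w, V w)) (isMeasurableFun.Build _ _ _ _ _ mUV).
pose PU := distribution P U'; pose PV := distribution P V'.
pose f z := a z.1 * b z.2.
have mf : measurable_fun setT (EFin \o f).
  by apply/measurable_EFinP/measurable_funM; exact: measurableT_comp.
have prodE X : measurable X -> (PU \x PV)%E X = distribution P UV' X.
  by move: X; apply: product_measure_unique => A B mA mB; rewrite -UV.
have ifUV := bounded_mfun_integrable P _ (bounded_mfunM _ _ ba bb).
have iaU := bounded_mfun_integrable P _ ba.
have ibV := bounded_mfun_integrable P _ bb.
have ia : PU.-integrable setT (EFin \o a).
  by apply: integrable_pushforward => //; exact/measurable_EFinP.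
have ib : PV.-integrable setT (EFin \o b).
  by apply: integrable_pushforward => //; exact/measurable_EFinP.
have iUV : (PU \x PV)%E.-integrable setT (EFin \o f).
  have /integrableP[_ fy] : (distribution P UV').-integrable setT (EFin \o f).
    exact: integrable_pushforward.
  apply/integrableP; split => //.
  rewrite (eq_measure_integral (distribution P UV'))// => A mA _.
  exact: prodE.
transitivity (\int[(PU \x PV)%E]_z f z).
  rewrite /Rintegral (eq_measure_integral (distribution P UV')); last first.
    by move=> A mA _; exact: prodE.
  by rewrite integral_distribution.
have iU : \int[PU]_x a x = \int[P]_w a (U w).
  by rewrite /Rintegral integral_distribution//; exact/measurable_EFinP.
have iV : \int[PV]_x b x = \int[P]_w b (V w).
  by rewrite /Rintegral integral_distribution//; exact/measurable_EFinP.
rewrite -iU -iV -RintegralZr// /Rintegral -integral12_prod_meas1//; congr fine.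
apply: eq_integral => x _; rewrite /fubini_F /f/=.
under eq_integral do rewrite EFinM.
rewrite integralZl// EFinM fineK//; exact: integrable_fin_num.
Qed.

Context {dS} {S : measurableType dS} {I : choiceType} (W : I -> {RV P >-> S}).
Context (indW : mutually_independent W).

(* Events on finitely many of the W k with k != i: a pi-system that generates
   the sigma-algebra of all the W k with k != i. *)
Let cylinder (i : I) : set (set T) := [set E | exists J : {fset I},
  exists A : I -> set S, [/\ i \notin J, forall k, measurable (A k) &
    E = \bigcap_(k in [set` J]) (W k @^-1` A k)]].

(** Both sides are finite measures in E; by mutual independence they agree on the
    pi-system of cylinders, hence on the sigma-algebra that it generates. *)
Lemma independent_of_others (i : I) (B : set S) (E : set T) : measurable B ->
  <<s cylinder i >> E ->
  P (E `&` W i @^-1` B) = (P E * P (W i @^-1` B))%E.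
Proof.
move=> mB sE.
have mW k A : measurable A -> measurable (W k @^-1` A).
  have mWk : measurable_fun setT (W k) by [].
  by move=> mA; have := mWk measurableT A mA; rewrite setTI.
have pfin : P (W i @^-1` B) \is a fin_num by apply: fin_num_measure; exact: mW.
have p0 : 0 <= fine (P (W i @^-1` B)) by rewrite fine_ge0.
rewrite -[RHS]muleC -[in RHS](fineK pfin).
have mcyl : cylinder i `<=` measurable.
  move=> _ [J [A [_ mA ->]]]; apply: fin_bigcap_measurable.
    exact: finite_fset.
  by move=> k _; exact: mW.
apply: (g_sigma_algebra_measure_unique (cylinder i) mcyl (fun=> setT) _ _
  (mrestr P (mW i B mB)) (mscale (NngNum p0) P)) => //.
- move=> _; exists fset0, (fun=> setT); split=> //.
  by rewrite set_fset0 bigcap_set0.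
- by rewrite bigcup_const.
- move=> _ _ [J [A [iJ mA ->]]] [J' [A' [iJ' mA' ->]]].
  (* Outside of its own index set a cylinder puts no constraint. *)
  pose Q (F : {fset I}) (C : I -> set S) k := if k \in F then C k else setT.
  exists (J `|` J')%fset, (fun k => Q J A k `&` Q J' A' k); split.
  - by rewrite in_fsetU negb_or iJ.
  - by move=> k; apply: measurableI; rewrite /Q; case: ifP.
  - apply/seteqP; split => [w [Aw A'w] k /= _|w AA'w].
      by rewrite /Q; split; case: ifPn => // kJ; [exact: Aw|exact: A'w].
    split => k /= kJ.
      have /= := AA'w k; rewrite in_fsetU kJ /Q kJ => /(_ isT)[]//.
    have /= := AA'w k; rewrite in_fsetU kJ orbT /Q kJ => /(_ isT)[]//.
- move=> _ [J [A [iJ mA ->]]].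
  change (P (\bigcap_(k in [set` J]) (W k @^-1` A k) `&` W i @^-1` B) =
    (fine (P (W i @^-1` B)))%:E * P (\bigcap_(k in [set` J]) (W k @^-1` A k)))%E.
  rewrite (fineK pfin).
  (* The two events are merged into one cylinder on the family J + i. *)
  pose A' k := if k == i then B else A k.
  have mA' k : measurable (A' k) by rewrite /A'; case: ifP.
  have A'E k : k \in J -> A' k = A k.
    by move=> kJ; rewrite /A' ifN//; apply: contraNneq iJ => <-.
  have -> : \bigcap_(k in [set` J]) (W k @^-1` A k) `&` W i @^-1` B =
      \bigcap_(k in [set` (i |` J)%fset]) (W k @^-1` A' k).
    apply/seteqP; split => [w [Aw Bw] k /=|w A'w].
      rewrite in_fset1U /A'; have [->//|_ /= kJ] := eqVneq k i; exact: Aw.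
    split => [k /= kJ|].
      have /= := A'w k; rewrite in_fset1U kJ orbT A'E// => /(_ isT); exact.
    by have /= := A'w i; rewrite fset1U1 /A' eqxx => /(_ isT).
  rewrite !indW// big_fsetU1//= {1}/A' eqxx; congr (_ * _)%E.
  by apply: eq_big_seq => k kJ; rewrite A'E.
- move=> k; change (P (setT `&` W i @^-1` B) < +oo)%E.
  rewrite setTI ltey_eq; apply/orP; left; apply: fin_num_measure; exact: mW.
Qed.

Lemma sum_independent_of_others (r : seq I) (i : I) (x : S -> R)
    (A : set R) (B : set S) :
  measurable_fun setT x -> measurable A -> measurable B ->
  let U w := \sum_(j <- r | j != i) x (W j w) in
  P (U @^-1` A `&` W i @^-1` B) = (P (U @^-1` A) * P (W i @^-1` B))%E.
Proof.
move=> mx mA mB U; apply: independent_of_others => //.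
pose T' := g_sigma_algebraType (cylinder i).
suff mU : measurable_fun [set: T'] (U : T' -> R).
  have := mU measurableT A mA; rewrite setTI; exact.
rewrite /U; under eq_fun do rewrite big_mkcond; apply: measurable_sum => j.
have [_|ji] := eqVneq j i; first exact: measurable_cst.
apply: measurableT_comp => // _ C mC; rewrite setTI.
apply: sub_sigma_algebra; exists [fset j]%fset, (fun=> C); split => //.
  by rewrite in_fset1 eq_sym.
by rewrite set_fset1 bigcap_set1.
Qed.

End independence.

(** * Stein's identity for a sum of independent variables *)

Section stein_sum.
Context {d} {T : measurableType d} {R : realType} (P : probability T R).
Context {I : finType} (X : I -> T -> R) (t : I -> R).
Context (bX : forall i, bounded_mfun (X i)).
Context (EX : forall i, \int[P]_w X i w = 0).
Context (EX2 : forall i, \int[P]_w (X i w ^+ 2) = t i).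

Let S w := \sum_i X i w.
Let U i w := \sum_(j | j != i) X j w.
Let v := \sum_i t i.

(* The form in which independence enters: the Taylor terms in X i can be
   integrated separately from the functions of U i that multiply them. *)
Context (UX : forall i (a b : R -> R), continuous a -> continuous b ->
  \int[P]_w (a (U i w) * b (X i w)) =
  \int[P]_w a (U i w) * \int[P]_w b (X i w)).

Let bS : bounded_mfun S. Proof. exact: bounded_mfun_sum. Qed.

Let bU i : bounded_mfun (U i). Proof. exact: bounded_mfun_sum. Qed.

Let SE i w : S w = U i w + X i w.
Proof. by rewrite /S (bigD1 i)//= addrC. Qed.

Let t_ge0 i : 0 <= t i.
Proof. by rewrite -EX2; apply: Rintegral_ge0 => w _; exact: sqr_ge0. Qed.

Let EUX i (a : R -> R) : continuous a -> \int[P]_w (a (U i w) * X i w) = 0.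
Proof.
by move=> ca; rewrite (UX i a (fun x => x))// ?EX ?mulr0// => x; exact: cvg_id.
Qed.

Let EUX2 i (a : R -> R) : continuous a ->
  \int[P]_w (a (U i w) * X i w ^+ 2) = t i * \int[P]_w a (U i w).
Proof.
move=> ca; rewrite (UX i a (fun x => x ^+ 2))// ?EX2 1?mulrC//.
exact: exprn_continuous.
Qed.

Lemma second_moment_sum : \int[P]_w (S w ^+ 2) = v.
Proof.
transitivity (\int[P]_w (\sum_i (S w * X i w))).
  by apply: eq_Rintegral => w _; rewrite expr2 -mulr_sumr.
rewrite Rintegral_sum_bounded; last by move=> i; exact: bounded_mfunM.
apply: eq_bigr => i _.
transitivity (\int[P]_w (U i w * X i w + X i w ^+ 2)).
  by apply: eq_Rintegral => w _; rewrite (SE i) mulrDl.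
rewrite RintegralD_bounded; [|exact: bounded_mfunM|exact: bounded_mfunX].
by rewrite EX2 (EUX i (fun x => x)) ?add0r// => x; exact: cvg_id.
Qed.

(* E[S^2] = E[(U i)^2] + t i, because the cross term vanishes. *)
Let EU2_le i : \int[P]_w (U i w ^+ 2) <= v.
Proof.
rewrite -second_moment_sum.
have -> : \int[P]_w (S w ^+ 2) = \int[P]_w (U i w ^+ 2) + t i.
  transitivity (\int[P]_w (2 * (U i w * X i w) + (U i w ^+ 2 + X i w ^+ 2))).
    by apply: eq_Rintegral => w _; rewrite (SE i); ring.
  have bUX : bounded_mfun (fun w => U i w * X i w) by exact: bounded_mfunM.
  have bU2 : bounded_mfun (fun w => U i w ^+ 2) by exact: bounded_mfunX.
  have bX2 : bounded_mfun (fun w => X i w ^+ 2) by exact: bounded_mfunX.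
  rewrite RintegralD_bounded ?RintegralZl_bounded ?RintegralD_bounded//.
  - by rewrite EX2 (EUX i (fun x => x)) ?mulr0 ?add0r// => x; exact: cvg_id.
  - by apply: bounded_mfunM => //; exact: bounded_mfun_cst.
  - exact: bounded_mfunD.
by rewrite lerDl.
Qed.

(** For the normal law of variance v the discrepancy E[S g(S)] - v E[g'(S)]
    vanishes.  For a sum it is bounded by expanding g(S) around the sum U i of
    the other terms: the term of order 0 vanishes since X i is centred, the term
    of order 1 is t i * E[g'(U i)], and both the Taylor remainder and the
    replacement of U i by S in g' cost at most e * t i * E[1 + (U i)^2]. *)
Lemma stein_discrepancy_le (g g' : R -> R) (e D : R) :
  (forall x : R, is_derive x 1 g (g' x)) -> continuous g' ->
  (forall z y, `|y| <= D -> `|g' (z + y) - g' z| <= e * (1 + z ^+ 2)) ->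
  0 <= e -> (forall i w, `|X i w| <= D) ->
  `|\int[P]_w (S w * g (S w)) - v * \int[P]_w g' (S w)| <= 2 * e * v * (1 + v).
Proof.
move=> dg cg' Hg' e0 XD.
have cg := is_derive_continuous _ _ dg.
have bgS : bounded_mfun (fun w => g (S w)) by exact: bounded_mfun_continuous.
have bg'S : bounded_mfun (fun w => g' (S w)) by exact: bounded_mfun_continuous.
have -> : \int[P]_w (S w * g (S w)) = \sum_i \int[P]_w (X i w * g (S w)).
  rewrite -Rintegral_sum_bounded; last by move=> i; exact: bounded_mfunM.
  by apply: eq_Rintegral => w _; rewrite -mulr_suml.
rewrite /v mulr_suml -sumrB -/v.
rewrite (le_trans (ler_norm_sum _ _ _))//.
rewrite {1}/v mulr_sumr mulr_suml; apply: ler_sum => i _.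
have bgU : bounded_mfun (fun w => g (U i w)) by exact: bounded_mfun_continuous.
have bg'U : bounded_mfun (fun w => g' (U i w)) by exact: bounded_mfun_continuous.
have b1U : bounded_mfun (fun w => 1 + U i w ^+ 2).
  by apply: bounded_mfunD; [exact: bounded_mfun_cst|exact: bounded_mfunX].
pose r w := X i w * (g (S w) - g (U i w) - X i w * g' (U i w)).
have br : bounded_mfun r.
  apply: bounded_mfunM => //; apply: bounded_mfunB; first exact: bounded_mfunB.
  exact: bounded_mfunM.
have E1U : \int[P]_w (1 + U i w ^+ 2) <= 1 + v.
  rewrite RintegralD_bounded ?Rintegral_cst_probability ?lerD2l//.
    exact: bounded_mfun_cst.
  exact: bounded_mfunX.
have -> : \int[P]_w (X i w * g (S w)) =
    t i * \int[P]_w g' (U i w) + \int[P]_w r w.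
  transitivity
    (\int[P]_w (g (U i w) * X i w + (g' (U i w) * X i w ^+ 2 + r w))).
    by apply: eq_Rintegral => w _; rewrite /r; ring.
  have bgX2 : bounded_mfun (fun w => g' (U i w) * X i w ^+ 2).
    by apply: bounded_mfunM => //; exact: bounded_mfunX.
  rewrite RintegralD_bounded ?EUX ?add0r;
    [|by []|exact: bounded_mfunM|exact: bounded_mfunD].
  by rewrite RintegralD_bounded// EUX2.
rewrite addrAC -mulrBr -RintegralB_bounded//.
rewrite (le_trans (ler_normD _ _))//.
rewrite (_ : 2 * e * t i * (1 + v) = t i * (e * (1 + v)) + t i * (e * (1 + v)));
  last by ring.
rewrite lerD//.
  rewrite normrM (ger0_norm (t_ge0 i)) ler_wpM2l//.
  apply: (@le_trans _ _ (\int[P]_w (e * (1 + U i w ^+ 2)))).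
    apply: normr_Rintegral_le_bounded; [exact: bounded_mfunB| |].
      by apply: bounded_mfunM; [exact: bounded_mfun_cst|].
    by move=> w; rewrite distrC (SE i); exact: Hg'.
  by rewrite RintegralZl_bounded// ler_wpM2l.
apply: (@le_trans _ _ (\int[P]_w (e * ((1 + U i w ^+ 2) * X i w ^+ 2)))).
  apply: normr_Rintegral_le_bounded => //.
    apply: bounded_mfunM; first exact: bounded_mfun_cst.
    by apply: bounded_mfunM; [|exact: bounded_mfunX].
  move=> w; rewrite /r normrM (SE i).
  have := quadratic_taylor g g' e D dg Hg' (U i w) (X i w) (XD i w).
  move/(ler_wpM2l (normr_ge0 (X i w)))/le_trans; apply.
  rewrite -[X i w ^+ 2]real_normK ?num_real// [leLHS](_ : _ =
    e * ((1 + U i w ^+ 2) * `|X i w| ^+ 2))//; ring.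
rewrite RintegralZl_bounded; last first.
  by apply: bounded_mfunM => //; exact: bounded_mfunX.
rewrite (EUX2 i (fun x => 1 + x ^+ 2)); last first.
  by move=> x; apply: cvgD; [exact: cvg_cst|exact: exprn_continuous].
by rewrite mulrCA !ler_wpM2l.
Qed.

End stein_sum.

(** * The central limit theorem for bounded variables *)

Section clt.
Context {d} {T : measurableType d} {R : realType} (P : probability T R).
Context {dS} {S : measurableType dS} (H : probability S R).
Context (W : nat -> {RV P >-> S}) (iidW : iid W H).

Let bounded_mfunW i (u : S -> R) : bounded_mfun u ->
  bounded_mfun (fun w => u (W i w)).
Proof. by move=> [mu [M uM]]; split; [exact: measurableT_comp|exists M]. Qed.

Lemma iid_Rintegral i (u : S -> R) : bounded_mfun u ->
  \int[P]_w u (W i w) = \int[H]_y u y.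
Proof.
move=> bu; rewrite /Rintegral; congr fine.
transitivity (\int[distribution P (W i)]_y (u y)%:E)%E.
  rewrite integral_distribution//; first by apply/measurable_EFinP; case: bu.
  by apply: bounded_mfun_integrable; exact: bounded_mfunW.
by apply: eq_measure_integral => A mA _; exact: iidW.2.
Qed.

Context (x : S -> R) (bx : bounded_mfun x) (Ex : \int[H]_y x y = 0).

Let v := \int[H]_y (x y ^+ 2).

Definition normalized_sum n w := (Num.sqrt n%:R)^-1 * \sum_(i < n) x (W i w).

Let X n (i : 'I_n) w := (Num.sqrt n%:R)^-1 * x (W i w).

Let normalized_sumE n w : normalized_sum n w = \sum_(i < n) X n i w.
Proof. by rewrite /normalized_sum mulr_sumr. Qed.

Let bX n (i : 'I_n) : bounded_mfun (X n i).
Proof.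
by apply: bounded_mfunM; [exact: bounded_mfun_cst|exact: bounded_mfunW].
Qed.

Let EX n (i : 'I_n) : \int[P]_w X n i w = 0.
Proof.
rewrite RintegralZl_bounded ?iid_Rintegral ?Ex ?mulr0//.
exact: bounded_mfunW.
Qed.

Let EX2 n (i : 'I_n) : \int[P]_w (X n i w ^+ 2) = v / n%:R.
Proof.
have bx2 : bounded_mfun (fun y => x y ^+ 2) by exact: bounded_mfunX.
transitivity (\int[P]_w (n%:R^-1 * x (W i w) ^+ 2)).
  by apply: eq_Rintegral => w _; rewrite exprMn exprVn sqr_sqrtr.
rewrite RintegralZl_bounded; last exact: (bounded_mfunW i (fun y => x y ^+ 2)).
by rewrite (iid_Rintegral i (fun y => x y ^+ 2))// mulrC.
Qed.

Let sum_EX2 n : (0 < n)%N -> \sum_(i < n) (v / n%:R) = v.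
Proof.
move=> n0; rewrite sumr_const card_ord -[LHS]mulr_natr divfK//.
by rewrite pnatr_eq0 -lt0n.
Qed.

Let UX n (i : 'I_n) (a b : R -> R) : continuous a -> continuous b ->
  \int[P]_w (a (\sum_(j | j != i) X n j w) * b (X n i w)) =
  \int[P]_w a (\sum_(j | j != i) X n j w) * \int[P]_w b (X n i w).
Proof.
move=> ca cb.
pose y z := (Num.sqrt n%:R)^-1 * x z.
have my : measurable_fun setT y by apply: measurable_funM => //; case: bx.
pose U w := \sum_(j <- index_iota 0 n | j != i) y (W j w).
have UE w : \sum_(j | j != i) X n j w = U w by rewrite /U big_mkord.
have bU : bounded_mfun U.
  by apply: bounded_mfun_sum => j; apply: bounded_mfunM;
    [exact: bounded_mfun_cst|exact: bounded_mfunW].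
have byW : bounded_mfun (fun w => y (W i w)) by exact: bX.
under eq_Rintegral do rewrite UE.
under [X in _ = X * _]eq_Rintegral do rewrite UE.
apply: (Rintegral_independent_mul P U (W i) a (fun z => b (y z))) => //.
- by case: bU.
- move=> A B mA mB; exact: (sum_independent_of_others P W iidW.1).
- exact: continuous_measurable_fun.
- by apply: measurableT_comp my; exact: continuous_measurable_fun.
- exact: bounded_mfun_continuous.
- exact: (bounded_mfun_continuous b (fun w => y (W i w))).
Qed.

Let bZ n : bounded_mfun (normalized_sum n).
Proof.
by rewrite (funext (normalized_sumE n)); exact: bounded_mfun_sum.
Qed.

(** Stein's equation turns E f(Z) - E f(N) into the discrepancy of
    [stein_discrepancy_le], evaluated at terms of size at most M / sqrt n. *)
Lemma bounded_clt : weakly_converges P normalized_sum (normal_law 0 v).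
Proof.
split; first by move=> n; case: (bZ n).
move=> f cf bf.
have bfZ n : bounded_mfun (fun w => f (normalized_sum n w)).
  exact: bounded_mfun_continuous.
have v0 : 0 <= v by apply: Rintegral_ge0 => y _; exact: sqr_ge0.
have EfZ n : 'E_P[f \o normalized_sum n]%E = (\int[P]_w f (normalized_sum n w))%:E.
  rewrite unlock /Rintegral fineK//; apply: integrable_fin_num => //.
  exact: (bounded_mfun_integrable P).
under eq_fun do rewrite EfZ.
have [vE0|vn0] := eqVneq v 0.
  (* The sums have second moment 0, hence vanish almost surely. *)
  have ZE n : \int[P]_w f (normalized_sum n w) = f 0.
    have Z2 : \int[P]_w (normalized_sum n w ^+ 2) = 0.
      under eq_Rintegral do rewrite normalized_sumE.
      rewrite (second_moment_sum P (X n) (fun=> v / n%:R) (bX n) (EX n) (EX2 n)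
        (UX n)).
      by rewrite vE0 mul0r big1.
    have bZ2 : bounded_mfun (fun w => normalized_sum n w ^+ 2).
      exact: bounded_mfunX.
    have aeZ : ae_eq P setT (EFin \o (fun w => normalized_sum n w ^+ 2)) (cst 0%E).
      apply/(ae_eq_integral_abs P) => //.
        by apply/measurable_EFinP; case: bZ2.
      have /integrable_fin_num Zfin := bounded_mfun_integrable P _ bZ2.
      rewrite -[RHS](congr1 EFin Z2) /Rintegral fineK; last exact: Zfin.
      by apply: eq_integral => w _ /=; rewrite ger0_norm// sqr_ge0.
    transitivity (\int[P]_(_ in setT) (f 0)); last exact: Rintegral_cst_probability.
    rewrite /Rintegral; congr fine.
    apply: ae_eq_integral => //.
    - by apply/measurable_EFinP; case: (bfZ n).
    - apply: filterS aeZ => w /(_ I) /= [] /eqP; rewrite sqrf_eq0 => /eqP -> //.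
  have -> : (\int[normal_law 0 v]_y (f y)%:E)%E = (f 0)%:E.
    rewrite /normal_law vE0 eqxx integral_dirac//.
      by rewrite diracE mem_set// mul1e.
    by apply/measurable_EFinP; exact: continuous_measurable_fun.
  by under eq_fun do rewrite ZE; exact: cvg_cst.
have s0 : Num.sqrt v != 0 by rewrite sqrtr_eq0 -ltNge lt0r vn0.
have [g [g' [dg cg' [C g'C] gE]]] := stein_equation_solvable _ _ s0 cf bf.
have -> : (\int[normal_law 0 v]_y (f y)%:E)%E =
    (\int[normal_prob 0 (Num.sqrt v)]_y f y)%:E.
  rewrite /normal_law (negbTE vn0) /Rintegral fineK//.
  apply: integrable_fin_num => //.
  apply: (bounded_mfun_integrable (normal_prob 0 _)).
  exact: continuous_bounded_mfun.
apply: cvg_EFin; first exact: nearW.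
apply/cvgrPdist_le => e e0.
have [M xM] := bx.2.
(* The discrepancy is at most 2 * e' * v * (1 + v), which has to be e. *)
pose e' := e / (2 * v * (1 + v)).
have v2 : 0 < 2 * v * (1 + v) by rewrite !mulr_gt0// ?ltr_wpDr// lt0r vn0.
have e'0 : 0 < e' by rewrite divr_gt0.
have [D D0 HD] := quadratic_modulus g' C cg' g'C _ e'0.
near=> n.
have n0 : (0 < n)%N by near: n; exact: nbhs_infty_gt.
have XD (i : 'I_n) w : `|X n i w| <= D.
  have sn : 0 < Num.sqrt n%:R :> R by rewrite sqrtr_gt0 ltr0n.
  rewrite normrM normfV (gtr0_norm sn) ler_pdivrMl// (le_trans (xM _))//.
  rewrite -ler_pdivrMr// (le_trans (ler_norm _))//.
  rewrite -sqrtr_sqr ler_sqrt ?ler0n//.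
  by near: n; exact: nbhs_infty_ger.
have := stein_discrepancy_le P (X n) (fun=> v / n%:R) (bX n) (EX n) (EX2 n) (UX n)
  g g' e' D dg cg' HD (ltW e'0) XD.
rewrite (sum_EX2 n n0).
have bg'Z : bounded_mfun (fun w => g' (normalized_sum n w)).
  exact: bounded_mfun_continuous.
have bgZ : bounded_mfun (fun w => g (normalized_sum n w)).
  by apply: bounded_mfun_continuous => //; exact: is_derive_continuous dg.
under eq_Rintegral do rewrite -normalized_sumE.
under [X in _ - _ * X]eq_Rintegral do rewrite -normalized_sumE.
move=> disc_le.
set c := (X in `|X - _|).
have -> : c - \int[P]_w f (normalized_sum n w) =
    \int[P]_w (normalized_sum n w * g (normalized_sum n w)) -
    v * \int[P]_w g' (normalized_sum n w).
  have bZg := bounded_mfunM _ _ (bZ n) bgZ.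
  have bvg' : bounded_mfun (fun w => v * g' (normalized_sum n w)).
    by apply: bounded_mfunM => //; exact: bounded_mfun_cst.
  rewrite -RintegralZl_bounded// -RintegralB_bounded//.
  rewrite -(Rintegral_cst_probability P c).
  rewrite -RintegralB_bounded//; last exact: bounded_mfun_cst.
  apply: eq_Rintegral => w _; rewrite -(opprB _ c) -gE sqr_sqrtr//.
  by rewrite opprB.
rewrite (le_trans disc_le)// [leLHS](_ : _ = e)// /e'.
by field; rewrite vn0 gt_eqF// ltr_wpDr.
Unshelve. all: by end_near.
Qed.

End clt.

(** * Asymptotic normality of the empirical depth *)

Theorem theorem7 (R : realType) (q : nat) (hq : (2 <= q)%N)
  (d : usphere R hq -> usphere R hq -> R)
  (d_dist : distance d) (d_bounded : bounded_distance d)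
  (d_meas : forall theta : usphere R hq,
     measurable_fun [set: usphere R hq] (d theta))
  (H : probability (usphere R hq) R) (theta : usphere R hq)
  (dO : measure_display) (Omega : measurableType dO) (P : probability Omega R)
  (W : nat -> {RV P >-> usphere R hq}) (W_iid : iid W H) :
  weakly_converges P
    (fun n omega => Num.sqrt n%:R *
       (depth d theta (empirical R (fun i => W i omega) n) - depth d theta H))
    (normal_law 0 (fine 'V_H[d theta])).
Proof.
have bd : bounded_mfun (d theta).
  split; first exact: d_meas.
  have [M dM] := d_bounded; exists M => y.
  by rewrite ger0_norm ?distance_ge0//; apply: dM; exists theta => //; exists y.
pose m := \int[H]_y d theta y.
(* The depth decreases with the distance, hence the sign of x. *)
pose x y := m - d theta y.
have bx : bounded_mfun x by apply: bounded_mfunB => //; exact: bounded_mfun_cst.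
have mE : fine 'E_H[d theta] = m by rewrite unlock.
have Ex : \int[H]_y x y = 0.
  rewrite RintegralB_bounded// ?Rintegral_cst_probability ?subrr//.
  exact: bounded_mfun_cst.
have -> : fine 'V_H[d theta] = \int[H]_y (x y ^+ 2).
  rewrite /variance unlock mE unlock /Rintegral; congr fine.
  by apply: eq_integral => y _ /=; congr EFin; rewrite !fctE/= /x; ring.
rewrite (_ : (fun n => _) = normalized_sum P W x); first exact: bounded_clt.
apply/funext => n; apply/funext => w; rewrite /normalized_sum.
(* For n = 0 both sides are 0, whatever the empirical measure is. *)
have [->|n0] := posnP n; first by rewrite sqrtr0 mul0r big_ord0 mulr0.
rewrite depth_empirical// /depth mE sumrB sumr_const card_ord -[m *+ n]mulr_natr.
have s0 : Num.sqrt n%:R != 0 :> R by rewrite gt_eqF// sqrtr_gt0 ltr0n.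
have : n%:R = Num.sqrt n%:R ^+ 2 :> R by rewrite sqr_sqrtr.
move: (Num.sqrt n%:R) s0 => s s0 ->.
by field.
Qed.
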